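(* For every (possibly infinite) graph $G$, $(\operatorname{odw}(G)-3)/6\le \operatorname{mcw}(G)\le \operatorname{odw}(G)$.
   Context: $d_G(u,v)$ denotes the length of a shortest $u$–$v$ path in $G$. A tree-decomposition of $G$ is a pair $(T,(B_t:t\in V(T)))$ where $T$ is a (possibly infinite) tree and $B_t\subseteq V(G)$, such that $V(G)=\bigcup_t B_t$; every edge has both ends in some $B_t$; and if $t_2$ lies on the $T$-path between $t_1,t_3$ then $B_{t_1}\cap B_{t_3}\subseteq B_{t_2}$. Its outer diameter is $\sup_t\max_{u,v\in B_t}d_G(u,v)$, and $\operatorname{odw}(G)$ is the minimum outer diameter over all tree-decompositions of $G$ (possibly $\infty$). The McCarty-width $\operatorname{mcw}(G)$ is the minimum integer $k\ge 0$ such that for every three vertices $u,v,w$ of $G$ there is a vertex $x$ such that, with $X$ the set of vertices at distance at most $k$ from $x$, no component of $G\setminus X$ contains two of $u,v,w$; $\operatorname{mcw}(G)=\infty$ if no such $k$ exists. *)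

(* Defs.v *)
From mathcomp Require Import all_boot all_order all_algebra.
From mathcomp Require Import all_classical all_reals all_analysis.

Set Implicit Arguments.
Unset Strict Implicit.
Unset Printing Implicit Defensive.

Local Open Scope classical_set_scope.
Local Open Scope ring_scope.
Local Open Scope ereal_scope.

(* The vertex set may be infinite. Asking for an eqType and a boolean
   adjacency loses no generality: classically every type T is an eqType
   through {classic T}, and every relation is boolean through asbool. *)
Record sgraph := SGraph {
  vertex :> eqType;
  adj : rel vertex;
  adj_sym : symmetric adj;
  adj_irr : irreflexive adj
}.

(* u :: p is a path from u to v without repeated vertex; its length is size p. *)
Definition upath (G : sgraph) (u v : G) (p : seq G) : bool :=
  [&& path (@adj G) u p, last u p == v & uniq (u :: p)].

(* +oo if u and v lie in different components. *)
Definition dist (R : realType) (G : sgraph) (u v : G) : \bar R :=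
  ereal_inf [set (size p)%:R%:E | p in [set p : seq G | upath u v p]].

Definition connected_graph (G : sgraph) : Prop :=
  forall u v : G, exists p, upath u v p.

Definition acyclic_graph (G : sgraph) : Prop :=
  forall c : seq G, (2 < size c)%N -> ~ ucycle (@adj G) c.

Definition is_tree (T : sgraph) : Prop :=
  [/\ inhabited T, connected_graph T & acyclic_graph T].

Record tree_decomposition (G : sgraph) := TreeDecomposition {
  td_tree : sgraph;
  td_treeP : is_tree td_tree;
  bag : td_tree -> set G;
  bag_cover : \bigcup_t bag t = [set: G];
  bag_edge : forall u v : G, adj u v -> exists t, bag t u /\ bag t v;
  bag_path : forall (t1 t2 t3 : td_tree) (p : seq td_tree),
    upath t1 t3 p -> t2 \in t1 :: p -> bag t1 `&` bag t3 `<=` bag t2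
}.

(* Distances are nonnegative, so adding 0 only matters for B empty, where it
   gives 0 instead of ereal_sup set0 = -oo. *)
Definition diameter (R : realType) (G : sgraph) (B : set G) : \bar R :=
  ereal_sup (0 |` [set dist R u v | u in B & v in B]).

Definition outer_diameter (R : realType) (G : sgraph)
    (D : tree_decomposition G) : \bar R :=
  ereal_sup (range (fun t : td_tree D => diameter R (bag t))).

(* Outer diameters are natural numbers or +oo, so the infimum is a minimum. *)
Definition odw (R : realType) (G : sgraph) : \bar R :=
  ereal_inf [set d | exists D : tree_decomposition G, d = outer_diameter R D].

Definition gball (R : realType) (G : sgraph) (x : G) (k : nat) : set G :=
  [set y | dist R x y <= k%:R%:E].

(* C is (the vertex set of) a component of G \ X. *)
Definition is_component_off (G : sgraph) (X C : set G) : Prop :=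
  exists2 u, ~ X u &
    C = [set v | exists2 p, upath u v p & forall z, z \in u :: p -> ~ X z].

Definition mccarty (R : realType) (G : sgraph) (k : nat) : Prop :=
  forall u v w : G, u <> v -> u <> w -> v <> w ->
  exists x : G, forall C : set G, is_component_off (gball R x k) C ->
    [/\ ~ (C u /\ C v), ~ (C u /\ C w) & ~ (C v /\ C w)].

(* +oo = ereal_inf set0 if no k works. *)
Definition mcw (R : realType) (G : sgraph) : \bar R :=
  ereal_inf [set k%:R%:E | k in [set k : nat | mccarty R G k]].

(* Main.v *)
Require Import Defs.
From mathcomp Require Import all_boot all_order all_algebra.
From mathcomp Require Import all_classical all_reals all_analysis.
From mathcomp Require Import zify lra.

Import Order.TTheory GRing.Theory Num.Theory.

(** Upper bound: given a tree-decomposition, the bag at the median of three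
    nodes whose bags contain [u], [v], [w] separates these vertices pairwise, and
    a bag of diameter at most [k] lies in the ball of radius [k] around any of
    its members.

    Lower bound: let [depth] be the distance to a root chosen in each component.
    The nodes of the tree are the components [C] of the subgraphs induced on
    [depth >= i], and the bag of [C] is its layer [depth = i] together with the
    neighbours of this layer in layer [i - 1].  If [u], [v] are in the same layer
    of [C], a ball of radius [k] around [x] that separates [u], [v] and the root
    meets a path of [C], hence [depth x >= i - k]; it also meets the geodesics
    from [u] and [v] to the root, in points of depth at least [i - 2k].  Hence
    [u] and [v] are within [3k] of [x], and within [6k] of each other, so bags have
    diameter at most [6k + 2]. *)

Local Open Scope ring_scope.
Local Open Scope ereal_scope.

(** * Walks, bounded reachability and separation *)

Section Walks.
Context {G : sgraph}.
Implicit Types (u v w : G) (P : set G) (n : nat).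

(** Vertices may repeat, so that walks concatenate freely; [walk_in_upath] extracts a path where one
    is required. *)
Definition walk_in P u v : Prop :=
  exists p : seq G, [/\ path (@adj G) u p, last u p = v &
    forall z, z \in u :: p -> P z].

(** The bound [n] on the distance, stated without extended reals; [reachP] makes the link with
    [dist]. *)
Definition reach n u v : Prop :=
  exists p : seq G, [/\ path (@adj G) u p, last u p = v & (size p <= n)%N].

Lemma adjC u v : adj u v = adj v u.
Proof. exact: adj_sym. Qed.

Lemma path_rev u (p : seq G) : path (@adj G) u p ->
  path (@adj G) (last u p) (rev (belast u p)).
Proof.
move=> up; rewrite rev_path (eq_path (e' := @adj G)) // => x y.
exact: adj_sym.
Qed.

Lemma last_rev_belast u (p : seq G) : last (last u p) (rev (belast u p)) = u.
Proof. by case: p => //= x p; rewrite rev_cons last_rcons. Qed.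

Lemma walk_in_refl P u : P u -> walk_in P u u.
Proof. by move=> Pu; exists [::]; split=> // z /[!inE] /eqP->. Qed.

Lemma walk_in_adj P u v : P u -> P v -> adj u v -> walk_in P u v.
Proof.
move=> Pu Pv uv; exists [:: v]; split=> //= [|z]; first by rewrite uv.
by rewrite !inE => /orP[] /eqP->.
Qed.

Lemma walk_in_sym P u v : walk_in P u v -> walk_in P v u.
Proof.
move=> [p [up <- pP]]; exists (rev (belast u p)); split.
- exact: path_rev.
- exact: last_rev_belast.
- move=> z; rewrite inE mem_rev => zp; apply: pP.
  by rewrite lastI mem_rcons inE.
Qed.

Lemma walk_in_trans P u v w : walk_in P u v -> walk_in P v w -> walk_in P u w.
Proof.
move=> [p [up <- pP]] [q [vq <- qP]]; exists (p ++ q); split.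
- by rewrite cat_path up.
- by rewrite last_cat.
- move=> z; rewrite -cat_cons mem_cat => /orP[/pP//|zq].
  by apply: qP; rewrite inE zq orbT.
Qed.

Lemma walk_in_sub P (Q : set G) u v : (forall z, P z -> Q z) ->
  walk_in P u v -> walk_in Q u v.
Proof. by move=> PQ [p [up <- pP]]; exists p; split=> // z /pP/PQ. Qed.

Lemma walk_in_upath P u v : walk_in P u v ->
  exists2 p : seq G, upath u v p & forall z, z \in u :: p -> P z.
Proof.
move=> [p [up <- pP]].
case/shortenP: (up) => q uq uniqq qp; exists q; first exact/and3P.
move=> z; rewrite inE => /orP[/eqP->|zq]; apply: pP; first exact: mem_head.
by rewrite inE qp ?orbT.
Qed.

Lemma reachW m n u v : (m <= n)%N -> reach m u v -> reach n u v.
Proof. by move=> mn [p [? ? pm]]; exists p; split=> //; apply: leq_trans mn. Qed.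

Lemma reach_refl n u : reach n u u.
Proof. by exists [::]. Qed.

Lemma reach_adj u v : adj u v -> reach 1 u v.
Proof. by move=> uv; exists [:: v]; split=> //=; rewrite uv. Qed.

Lemma reach_sym n u v : reach n u v -> reach n v u.
Proof.
move=> [p [up <- pn]]; exists (rev (belast u p)); split.
- exact: path_rev.
- exact: last_rev_belast.
- by rewrite size_rev size_belast.
Qed.

Lemma reach_trans m n u v w : reach m u v -> reach n v w -> reach (m + n) u w.
Proof.
move=> [p [up <- pm]] [q [vq <- qn]]; exists (p ++ q); split.
- by rewrite cat_path up.
- by rewrite last_cat.
- by rewrite size_cat leq_add.
Qed.

Lemma walk_reach P u v : walk_in P u v -> exists n, reach n u v.
Proof. by move=> [p [? ? _]]; exists (size p), p. Qed.

(** A finite infimum of path lengths is attained, the lengths being natural numbers. The bound [r]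
    is real because an outer diameter is a priori only an extended real. *)
Lemma reach_le_dist (R : realType) u v (r : R) :
  dist R u v <= r%:E -> exists2 n, reach n u v & (n%:R <= r)%R.
Proof.
move=> uvr.
have [[p0 up0]|nop] := pselect (exists p, upath u v p); last first.
  suff doo : dist R u v = +oo by rewrite doo in uvr.
  rewrite /dist (_ : [set p | _]%classic = classical_sets.set0) ?image_set0 ?ereal_inf0 //.
  by rewrite -subset0 => p /= up; apply: nop; exists p.
have exq : exists n, `[< exists2 p, upath u v p & size p = n >].
  by exists (size p0); apply/asboolP; exists p0.
case: (ex_minnP exq) => n /asboolP[p up pn] nmin.
have : n%:R%:E <= dist R u v.
  apply: le_ereal_inf_tmp => _ [q uq <-]; rewrite lee_fin ler_nat.
  by apply: nmin; apply/asboolP; exists q.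
move=> /le_trans/(_ uvr); rewrite lee_fin => nr; exists n => //.
by exists p; case/and3P: up => ? /eqP ? _; split=> //; rewrite pn.
Qed.

Lemma reachP (R : realType) n u v : dist R u v <= n%:R%:E <-> reach n u v.
Proof.
split=> [/reach_le_dist[m uvm]|[p [up <- pn]]].
  by rewrite ler_nat => mn; apply: reachW uvm.
case/shortenP: (up) => q uq uniqq qp.
apply: (@le_trans _ _ (size q)%:R%:E).
  by apply: ereal_inf_lbound; exists q => //; apply/and3P.
by rewrite lee_fin ler_nat (leq_trans _ pn)// uniq_leq_size//; case/andP: uniqq.
Qed.

(** A walk avoiding [P] would put both of its ends in the component of [u] off [P]. *)
Lemma walk_meets_separator P u v (p : seq G) :
  (forall C, is_component_off P C -> ~ (C u /\ C v)) ->
  path (@adj G) u p -> last u p = v -> exists2 z, z \in u :: p & P z.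
Proof.
move=> sepP up upv; apply: contrapT => noz.
have pP z : z \in u :: p -> ~ P z by move=> zp Pz; apply: noz; exists z.
pose C := [set v | exists2 p, upath u v p & forall z, z \in u :: p -> ~ P z]%classic.
apply: (sepP C); first by exists u => //; apply: pP; exact: mem_head.
split; last by apply: (walk_in_upath (fun z => ~ P z)); exists p.
by apply: (walk_in_upath (fun z => ~ P z)); apply: walk_in_refl; apply/pP/mem_head.
Qed.

Lemma separatedP P u v : ~ walk_in (fun z => ~ P z) u v ->
  forall C, is_component_off P C -> ~ (C u /\ C v).
Proof.
move=> nuv C [w Pw ->] /= [[p wup pP] [q wvq qP]]; apply: nuv.
apply: (walk_in_trans _ _ w).
  by apply: walk_in_sym; exists p; case/and3P: wup => ? /eqP.
by exists q; case/and3P: wvq => ? /eqP.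
Qed.

End Walks.

(** * Acyclic graphs: uniqueness of paths, and medians *)

Section AcyclicGraphs.
Context {T : sgraph}.
Hypothesis acT : acyclic_graph T.

(** If the two paths leave [u] through distinct neighbours [x] and [y], following one to [v] and the
    other back joins [x] to [y] off [u], which closes a cycle through [u]. *)
Lemma upath_unique (u v : T) (p q : seq T) : upath u v p -> upath u v q -> p = q.
Proof.
elim: p u q => [|x p IHp] u q.
  case: q => // y q /and3P[_ /= /eqP <- _] /and3P[_ /= /eqP uq].
  by rewrite -{1}uq mem_last.
case: q => [|y q].
  move=> /and3P[_ /= /eqP uq uniqp] /and3P[_ /= /eqP uv _].
  by move: uniqp; rewrite uv -uq mem_last.
move=> /and3P[/= /andP[ux xp] xpv /andP[uxp uniqp]].
move=> /and3P[/= /andP[uy yq] yqv /andP[uyq uniqq]].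
have [xy|/eqP xy] := eqVneq x y.
  rewrite xy in xp xpv uniqp *; congr cons.
  by apply: (IHp y); apply/and3P; split.
exfalso.
have : walk_in (fun z => z <> u) x y.
  apply: (walk_in_trans _ _ v); last apply: walk_in_sym.
    by exists p; split=> [//||z zp zu]; [exact/eqP|rewrite -zu zp in uxp].
  by exists q; split=> [//||z zq zu]; [exact/eqP|rewrite -zu zq in uyq].
move=> /walk_in_upath[s /and3P[xs /eqP xsy uniqs] su].
(* As [x] and [y] differ, the cycle has at least three vertices. *)
have s0 : (0 < size s)%N by case: s xsy {xs uniqs su} => //= /xy.
apply: (acT (u :: x :: s)) => //.
rewrite /ucycle /= rcons_path ux xs xsy adjC uy /=.
move: uniqs; rewrite /= => ->; rewrite andbT.
by apply/negP => us; exact: (su u).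
Qed.

Lemma upath_separates (a b t : T) (p : seq T) : upath a b p -> t \in a :: p ->
  ~ walk_in (fun z => z <> t) a b.
Proof.
move=> abp tp /walk_in_upath[q abq qt].
by apply: (qt t) => //; rewrite -(upath_unique _ _ _ _ abp abq).
Qed.

Lemma split_first (A : pred T) (u : T) (p : seq T) : A (last u p) ->
  exists p1 t p2, [/\ u :: p = p1 ++ t :: p2, A t & forall z, z \in p1 -> ~~ A z].
Proof.
elim: p u => [|x p IHp] u /= Al; first by exists [::], u, [::].
case Au: (A u); first by exists [::], u, (x :: p).
have [p1 [t [p2 [-> At p1A]]]] := IHp _ Al.
by exists (u :: p1), t, p2; split=> // z; rewrite inE => /orP[/eqP->|/p1A//]; rewrite Au.
Qed.

(** Take for [t] the first vertex of the path from [c] to [a] that lies on the path from [a] to [b];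
    it is on the paths between all three pairs. *)
Lemma median (a b c : T) : connected_graph T ->
  exists t, [/\ ~ walk_in (fun z => z <> t) a b,
    ~ walk_in (fun z => z <> t) a c & ~ walk_in (fun z => z <> t) b c].
Proof.
move=> coT; have [p abp] := coT a b.
have [q caq] := coT c a.
have : (mem (a :: p)) (last c q).
  by case/and3P: caq => _ /eqP-> _; exact: mem_head.
case/(split_first (mem (a :: p))) => q1 [t [q2 [cqE tp q1p]]].
have [p1 [p2 apE]] : exists p1 p2, a :: p = p1 ++ t :: p2.
  by case/splitPr: tp => p1 p2; exists p1, p2.
(* The path from [c] to [b] follows [q] up to [t], then [p]; as [t] is the first common vertex,
   nothing is repeated. *)
have [s cbs ts] : exists2 s, upath c b s & t \in c :: s.
  have tp2 : path (@adj T) t p2 /\ last t p2 = b.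
    have /and3P[/= ap /eqP <- _] := abp.
    case: p1 apE => [[<- <-]|a' p1 [_ pE]] //.
    by move: ap; rewrite pE cat_path last_cat /= => /and3P[].
  have uniqtp2 : uniq (t :: p2).
    by case/and3P: abp => _ _; rewrite apE cat_uniq => /and3P[].
  have q1p2 : ~~ has (mem q1) (t :: p2).
    apply/hasPn => z zp2; apply/negP => /q1p /negP; apply.
    by rewrite /= apE mem_cat zp2 orbT.
  case: q1 cqE q1p q1p2 => [[-> _] _ _|c' q1 [<- qE] q1p q1p2].
    exists p2; last exact: mem_head.
    by apply/and3P; split=> //; [case: tp2|apply/eqP; case: tp2].
  exists (q1 ++ t :: p2); last by rewrite inE mem_cat mem_head !orbT.
  have /and3P[cq _] := caq; move: cq; rewrite qE cat_path -cat_cons cat_uniq.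
  move=> /= /and3P[cq1 q1t _] /andP[uniqq1 _].
  apply/and3P; split.
  - by rewrite cat_path cq1 /= q1t; case: tp2.
  - by rewrite last_cat /=; apply/eqP; case: tp2.
  - by rewrite -cat_cons cat_uniq q1p2 uniqtp2 /= uniqq1.
exists t; split.
- exact: upath_separates abp tp.
- have tq : t \in c :: q by rewrite cqE mem_cat mem_head orbT.
  by move/walk_in_sym; apply: upath_separates caq tq.
- by move/walk_in_sym; apply: upath_separates cbs ts.
Qed.

End AcyclicGraphs.

(** * Trees given by a parent function and a level *)

Section RootedTrees.
Context {T : eqType} (par : T -> T) (lev : T -> nat) (root : T).
Hypotheses (lev0 : forall x, lev x = 0%N -> x = root)
  (lev_par : forall x, lev (par x) = (lev x).-1).

(** The root is its own parent, since levels stop at 0; [x != y] removes this loop. *)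
Definition parent_adj (x y : T) := (x != y) && ((par x == y) || (par y == x)).

Lemma parent_adj_sym : symmetric parent_adj.
Proof. by move=> x y; rewrite /parent_adj eq_sym orbC. Qed.

Lemma parent_adj_irr : irreflexive parent_adj.
Proof. by move=> x; rewrite /parent_adj eqxx. Qed.

Definition parent_graph := SGraph parent_adj_sym parent_adj_irr.

(** A child has a larger level than its parent, except at level 0, where both vertices would be the
    root. *)
Lemma parent_adj_lev (x y : T) : parent_adj x y -> (lev y <= lev x)%N -> par x = y.
Proof.
case/andP=> /eqP xy /orP[/eqP//|/eqP yx].
have := lev_par y; rewrite yx; case ly: (lev y) => [|n] -> /=; last by rewrite ltnn.
move=> _; case: xy; rewrite (lev0 _ ly); apply: lev0.
by rewrite -yx lev_par ly.
Qed.

Lemma exists_max_lev (s : seq T) : s != [::] ->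
  exists2 x, x \in s & forall y, y \in s -> (lev y <= lev x)%N.
Proof.
elim: s => // x [_ _|y s /(_ isT)[m ms mmax] _].
  by exists x => [|y]; rewrite inE // => /eqP->.
have [mx|xm] := leqP (lev m) (lev x).
  exists x => [|z]; first exact: mem_head.
  by rewrite inE => /orP[/eqP->//|/mmax/leq_trans]; apply.
exists m => [|z]; first by rewrite inE ms orbT.
by rewrite inE => /orP[/eqP->|/mmax//]; apply: ltnW.
Qed.

(** On a cycle, both neighbours of a vertex of maximal level would be its parent. *)
Lemma parent_graph_acyclic : acyclic_graph parent_graph.
Proof.
move=> c c2 /andP[cc uniqc].
have [|x xc xmax] := exists_max_lev c; first by case: c c2 {cc uniqc}.
case: (rot_to xc) => i s cE.
have smax y : y \in x :: s -> (lev y <= lev x)%N by rewrite -cE mem_rot; apply: xmax.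
move: cc uniqc c2; rewrite -(rot_cycle i) -(rot_uniq i) -(size_rot i) cE.
case: s {cE} smax => [|y [|z s]] // smax.
rewrite /cycle rcons_path => /andP[/= /andP[xy _] lx] uniqs _.
have pxy := parent_adj_lev _ _ xy (smax y _).
have pxl : par x = last z s.
  apply: parent_adj_lev; first by rewrite parent_adj_sym.
  by apply: smax; rewrite in_cons in_cons mem_last !orbT.
move: uniqs; rewrite -pxy ?inE ?eqxx ?orbT// pxl => /and3P[_ /negP[]].
exact: mem_last.
Qed.

Lemma parent_graph_tree : is_tree parent_graph.
Proof.
split; [exact: (inhabits root)| |exact: parent_graph_acyclic].
have to_root : forall x : parent_graph, walk_in setT x (root : parent_graph).
  move=> x; elim: (lev x) {-2}x (erefl (lev x)) => [{}x /lev0->|n IHn {}x lx].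
    exact: walk_in_refl.
  apply: (walk_in_trans _ _ (par x : parent_graph)).
    apply: walk_in_adj => //; rewrite /adj /= /parent_adj eqxx andbT.
    by apply/eqP => xp; have := lev_par x; rewrite -xp lx => /=; lia.
  by apply: IHn; rewrite lev_par lx.
move=> u v.
case: (walk_in_upath _ _ _ (walk_in_trans _ _ _ _ (to_root u) (walk_in_sym _ _ _ (to_root v)))).
by move=> p ? _; exists p.
Qed.

(** The nodes whose bags contain a given vertex will be a node [s] and some of its children. Paths
    being unique, it suffices to exhibit one in each case; [0 < lev s] keeps [s] from being its own
    parent. *)
Lemma parent_star (s t1 t2 t3 : parent_graph) (p : seq parent_graph) :
  (0 < lev s)%N -> t1 = s \/ par t1 = s -> t3 = s \/ par t3 = s ->
  upath t1 t3 p -> t2 \in t1 :: p -> [\/ t2 = t1, t2 = s | t2 = t3].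
Proof.
move=> s0 t1s t3s t13p.
have par_neq t : par t = s -> t != s.
  move=> ts; apply/eqP => tE; have := lev_par t; rewrite ts tE; lia.
have uq q : upath t1 t3 q -> p = q.
  exact: (upath_unique parent_graph_acyclic _ _ _ _ t13p).
have [t13|t13] := eqVneq t1 t3.
  rewrite (uq [::]) ?inE => [/eqP|]; first by constructor 1.
  by apply/and3P; split=> //; apply/eqP.
case: t1s t3s => [t1s|t1s] [t3s|t3s].
- by rewrite t1s t3s eqxx in t13.
- rewrite (uq [:: t3]) ?inE => [/orP[]/eqP|]; [by constructor 1|by constructor 3|].
  apply/and3P; split=> //=; last by rewrite inE t13.
  by rewrite /adj /= /parent_adj t13 t3s t1s eqxx orbT.
- rewrite (uq [:: t3]) ?inE => [/orP[]/eqP|]; [by constructor 1|by constructor 3|].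
  apply/and3P; split=> //=; last by rewrite inE t13.
  by rewrite /adj /= /parent_adj t13 t1s t3s eqxx.
- rewrite (uq [:: s; t3]) ?inE => [/or3P[]/eqP|];
    [by constructor 1|by constructor 2|by constructor 3|].
  have n1 := par_neq _ t1s; have n3 : s != t3 by rewrite eq_sym par_neq.
  apply/and3P; split=> //=; last by rewrite !inE negb_or n1 t13 n3.
  by rewrite /adj /= /parent_adj n1 n3 t1s t3s !eqxx orbT.
Qed.

End RootedTrees.

(** * Layers of a graph by distance to a root *)

Section Layering.
Context {G : sgraph} (depth : G -> nat).
Implicit Types u v : G.
Hypotheses (depth_adj : forall u v, adj u v -> (depth v <= (depth u).+1)%N)
  (depth_descent : forall u, (0 < depth u)%N ->
     exists v, adj u v /\ (depth v).+1 = depth u)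
  (depth_root : forall u v, depth u = 0%N -> depth v = 0%N ->
     walk_in setT u v -> u = v).

Lemma depth_reach n u v : reach n u v -> (depth v <= depth u + n)%N.
Proof.
move=> [p [up <- pn]]; apply: leq_trans (leq_add (leqnn _) pn).
elim: p u up {pn} => [|x p IHp] u /=; first by rewrite addn0.
by move=> /andP[/depth_adj ux /IHp]; lia.
Qed.

(** Repeatedly stepping to a neighbour of smaller depth gives a geodesic to the root, along which
    the distance from [u] is the drop in depth. *)
Lemma descent u : exists p : seq G, [/\ path (@adj G) u p,
  depth (last u p) = 0%N & forall z, z \in u :: p -> reach (depth u - depth z) u z].
Proof.
elim: (depth u) {-2}u (erefl (depth u)) => [{}u u0|n IHn {}u un].
  exists [::]; split=> // z; rewrite inE => /eqP->; exact: reach_refl.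
have [|v [uv vu]] := depth_descent u; first by rewrite un.
have vn : depth v = n by lia.
have [p [vp vp0 pP]] := IHn _ vn; exists (v :: p); split=> //=; first by rewrite uv.
move=> z; rewrite inE => /orP[/eqP->|zp]; first exact: reach_refl.
have vz := pP _ zp.
apply: reachW (reach_trans _ _ _ _ _ (reach_adj _ _ uv) vz).
(* The subtraction is truncated: [depth z > depth v] would put [z] at distance 0 from [v], against
   [depth_reach]. *)
have [zv|vz_depth] := leqP (depth z) (depth v); first by lia.
by have := depth_reach _ _ _ vz; lia.
Qed.

(** A class is the layer [depth = i] of one component of the subgraph induced on [depth >= i]. *)
Definition layer_eq u v : Prop :=
  depth u = depth v /\ walk_in (fun z => (depth u <= depth z)%N) u v.

Lemma layer_eq_refl u : layer_eq u u.
Proof. by split=> //; apply: walk_in_refl => /=. Qed.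

Lemma layer_eq_sym u v : layer_eq u v -> layer_eq v u.
Proof. by case=> uv /walk_in_sym; rewrite /layer_eq uv. Qed.

Lemma layer_eq_trans u v w : layer_eq u v -> layer_eq v w -> layer_eq u w.
Proof.
case=> uv wuv [vw wvw]; split; first exact: etrans vw.
by apply: walk_in_trans wuv _; rewrite uv.
Qed.

Lemma layer_reach (R : realType) k u v :
  mccarty R G k -> layer_eq u v -> reach (6 * k) u v.
Proof.
move=> mcG [duv wuv].
have [<-|/eqP uv] := eqVneq u v; first exact: reach_refl.
(* At depth 0 both vertices are the root of their component. Otherwise [u], [v] and the root are
   three distinct vertices, as [mccarty] requires. *)
have [u0|u0] := posnP (depth u).
  by case: uv; apply: depth_root; rewrite -?duv //; apply: walk_in_sub wuv.
have [p [up rp0 pP]] := descent u.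
have [q [vq rq0 qP]] := descent v.
have rpq : last v q = last u p.
  apply: depth_root => //; apply: (walk_in_trans _ _ v).
    by apply: walk_in_sym; exists q.
  apply: (walk_in_trans _ _ u); last by exists p.
  by apply: walk_in_sym; apply: walk_in_sub wuv.
have ur : u <> last u p by move=> ur; rewrite -ur in rp0; lia.
have vr : v <> last u p by move=> vr; rewrite -vr in rp0; lia.
have [x sepx] := mcG _ _ _ uv ur vr.
(* Applied to [w = u] and [w = v] with their descents to the common root; [z1] lies on the walk
   inside the component, [z2] on the descent. *)
have near w s : (forall z, z \in w :: s -> reach (depth w - depth z) w z) ->
    (depth u <= depth w <= depth u)%N -> path (@adj G) w s ->
    (forall C, is_component_off (gball R x k) C -> ~ (C w /\ C (last w s))) ->
    reach (3 * k) w x.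
  move=> sP wu ws sepw.
  have [z1 uz1 xz1] : exists2 z, (depth u <= depth z)%N & reach k x z.
    have [s' [us' lus' s'P]] := wuv.
    have [|z zs' /reachP xz] := walk_meets_separator (gball R x k) _ _ _ _ us' lus'.
      by move=> C /sepx[].
    by exists z => //; apply: s'P.
  have [z2 /sP wz2 /reachP xz2] := walk_meets_separator (gball R x k) _ _ _ sepw ws erefl.
  (* Since [depth u <= depth z1 <= depth x + k <= depth z2 + 2k], [w] is within [2k] of [z2], which
     is within [k] of [x]. *)
  apply: reachW (reach_trans _ _ _ _ _ wz2 (reach_sym _ _ _ xz2)).
  have := depth_reach _ _ _ xz1.
  by have := depth_reach _ _ _ (reach_sym _ _ _ xz2); lia.
have ux : reach (3 * k) u x.
  by apply: (near _ p) => //; [lia|move=> C /sepx[]].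
have vx : reach (3 * k) v x.
  by apply: (near _ q) => //; [lia|move=> C /sepx[]; rewrite rpq].
by apply: reachW (reach_trans _ _ _ _ _ ux (reach_sym _ _ _ vx)); lia.
Qed.

(** * The tree-decomposition built from the layers *)

Section LayerTree.
Context (rep pre : G -> G).
Hypotheses (layer_rep : forall u, layer_eq u (rep u))
  (rep_eq : forall u v, layer_eq u v -> rep u = rep v)
  (preP : forall u, (0 < depth u)%N -> adj u (pre u) /\ (depth (pre u)).+1 = depth u).

Lemma layer_eq_rep u v : rep u = rep v -> layer_eq u v.
Proof.
move=> uv; apply: (layer_eq_trans _ (rep u)); first exact: layer_rep.
by rewrite uv; apply/layer_eq_sym/layer_rep.
Qed.

Lemma depth_rep u : depth (rep u) = depth u.
Proof. by case: (layer_rep u). Qed.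

(* The node [Some s] stands for the layer of [s] when [s] is its chosen
   representative, and is a leaf with an empty bag otherwise; [None] joins the
   trees of the different components of [G]. *)
Definition layer_par (t : option G) : option G :=
  if t is Some s then
    if depth s == 0%N then None else Some (rep (pre s))
  else None.

(** The shift by one makes [None] the only node of level 0. *)
Definition layer_lev (t : option G) : nat :=
  if t is Some s then (depth s).+1 else 0%N.

Definition layer_bag (t : option G) : set G :=
  fun u => if t is Some s then
    rep u = s \/ exists v, [/\ rep v = s, adj u v & depth v = (depth u).+1]
  else False.

Lemma layer_lev0 t : layer_lev t = 0%N -> t = None.
Proof. by case: t. Qed.

Lemma layer_lev_par t : layer_lev (layer_par t) = (layer_lev t).-1.
Proof.
case: t => //= s; case: eqVneq => [->//|] /=; rewrite -lt0n => s0.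
by rewrite depth_rep; case: (preP _ s0).
Qed.

(** If [u] enters the bag of the layer of [v] as a neighbour of smaller depth, then [pre (rep v)]
    has the depth of [u] and is joined to it through [rep v] and [v] by vertices of no smaller
    depth. So both are in one class, and the node of [u] is the parent of [t]. *)
Lemma layer_bag_near t u : layer_bag t u ->
  t = Some (rep u) \/ layer_par t = Some (rep u).
Proof.
case: t => // s [<-|[v [<- uv dvu]]]; [by left|right=> /=].
rewrite depth_rep dvu /=; congr Some; apply: rep_eq.
have s0 : (0 < depth (rep v))%N by rewrite depth_rep dvu.
have [spre dpre] := preP _ s0; rewrite depth_rep dvu in dpre.
case: dpre => dpre; split=> //; rewrite dpre.
apply: (walk_in_trans _ _ (rep v)).
  by apply: walk_in_adj; rewrite ?dpre ?depth_rep ?dvu // adjC.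
apply: (walk_in_trans _ _ v).
  apply: walk_in_sym; have [_] := layer_rep v; apply: walk_in_sub => z.
  by rewrite dvu; apply: leq_trans.
by apply: walk_in_adj; rewrite ?dvu // adjC.
Qed.

Lemma layer_bag_rep u : layer_bag (Some (rep u)) u.
Proof. by left. Qed.

Lemma layer_bag_cover : (\bigcup_t layer_bag t = [set: G])%classic.
Proof.
rewrite -subTset => u _; exists (Some (rep u)) => //; exact: layer_bag_rep.
Qed.

(** An edge between two layers lies in the bag of its deeper end, an edge within a layer in the bag
    of that layer. *)
Lemma layer_bag_edge u v : adj u v -> exists t, layer_bag t u /\ layer_bag t v.
Proof.
move=> uv; have vu : adj v u by rewrite adjC.
have [lt|gt|eq] := ltngtP (depth u) (depth v).
- exists (Some (rep v)); split; last exact: layer_bag_rep.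
  by right; exists v; split=> //; have := depth_adj _ _ uv; lia.
- exists (Some (rep u)); split; first exact: layer_bag_rep.
  by right; exists u; split=> //; have := depth_adj _ _ vu; lia.
- exists (Some (rep u)); split; first exact: layer_bag_rep.
  left; apply/esym/rep_eq; split=> //.
  by apply: walk_in_adj; rewrite ?eq.
Qed.

Lemma layer_bag_path (t1 t2 t3 : parent_graph layer_par) (p : seq (parent_graph layer_par)) :
  upath t1 t3 p -> t2 \in t1 :: p ->
  (layer_bag t1 `&` layer_bag t3 `<=` layer_bag t2)%classic.
Proof.
move=> t13p t2p u [t1u t3u].
have := parent_star _ _ _ layer_lev0 layer_lev_par (Some (rep u)) _ _ _ _ (ltn0Sn _)
  (layer_bag_near _ _ t1u) (layer_bag_near _ _ t3u) t13p t2p.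
by case=> ->; [exact: t1u|exact: layer_bag_rep|exact: t3u].
Qed.

Definition layer_decomposition : tree_decomposition G :=
  TreeDecomposition (parent_graph_tree _ _ _ layer_lev0 layer_lev_par)
    layer_bag_cover layer_bag_edge layer_bag_path.

(** Each vertex of a bag is within 1 of the layer that defines it, whence [+ 2]. *)
Lemma layer_bag_reach n t u v : (forall x y, layer_eq x y -> reach n x y) ->
  layer_bag t u -> layer_bag t v -> reach (n + 2) u v.
Proof.
move=> nP.
have near w : layer_bag t w -> exists2 x, reach 1 w x & t = Some (rep x).
  case: t => // s [<-|[x [<- wx _]]]; first by exists w => //; apply: reach_refl.
  by exists x => //; apply: reach_adj.
move=> /near[x ux tx] /near[y vy]; rewrite tx => -[/layer_eq_rep/nP xy].
apply: reachW (reach_trans _ _ _ _ _ ux (reach_trans _ _ _ _ _ xy (reach_sym _ _ _ vy))).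
lia.
Qed.

End LayerTree.
End Layering.

(** * Existence of layerings, and the bound [6k + 2] on [odw] *)

Lemma exists_repr (T : Type) (E : T -> T -> Prop) : (forall x, E x x) ->
  (forall x y, E x y -> E y x) -> (forall x y z, E x y -> E y z -> E x z) ->
  exists rep : T -> T, (forall x, E x (rep x)) /\ forall x y, E x y -> rep x = rep y.
Proof.
move=> Exx Esym Etrans.
pose P x : pred {classic T} := fun y => `[< E x y >].
have exP x : exists y, P x y by exists x; apply/asboolP.
(* [xchoose] gives the same value on predicates that agree pointwise, so equivalent elements share
   their representative. *)
exists (fun x => xchoose (exP x)); split=> [x|x y xy].
  by have /asboolP := xchooseP (exP x).
apply: (eq_xchoose (exP x) (exP y)) => z; apply: asbool_equiv_eq.
by split; apply: Etrans => //; apply: Esym.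
Qed.

(** The root of a component is its chosen representative, and [depth] is the least length of a walk
    from it. *)
Lemma exists_layering (G : sgraph) : exists depth : G -> nat,
  [/\ forall u v, adj u v -> (depth v <= (depth u).+1)%N,
      forall u, (0 < depth u)%N -> exists v, adj u v /\ (depth v).+1 = depth u
    & forall u v, depth u = 0%N -> depth v = 0%N -> walk_in setT u v -> u = v].
Proof.
have [|||rep [repP rep_eq]] := exists_repr G (walk_in setT).
- by move=> u; apply: walk_in_refl.
- by move=> u v; apply: walk_in_sym.
- by move=> u v w; apply: walk_in_trans.
have /boolp.choice[depth depthP] : forall u, exists n,
    reach n (rep u) u /\ forall m, reach m (rep u) u -> (n <= m)%N.
  move=> u; have [n0 un0] := walk_reach _ _ _ (walk_in_sym _ _ _ (repP u)).
  have exn : exists n, `[< reach n (rep u) u >] by exists n0; apply/asboolP.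
  case: (ex_minnP exn) => n /asboolP nu nmin; exists n; split=> // m mu.
  by apply/nmin/asboolP.
have rep_adj u v : adj u v -> rep v = rep u.
  by move=> uv; apply/esym/rep_eq; apply: walk_in_adj.
have depth_adj u v : adj u v -> (depth v <= (depth u).+1)%N.
  move=> uv; rewrite -addn1; apply: (depthP v).2; rewrite (rep_adj _ _ uv).
  by apply: reach_trans (depthP u).1 (reach_adj _ _ uv).
exists depth; split=> // [u u0|u v u0 v0 /rep_eq].
  have [[p [rp lp pn]] _] := depthP u.
  (* The penultimate vertex of a shortest walk from the root is the required neighbour;
     [0 < depth u] excludes the empty walk. *)
  case/lastP: p rp lp pn => [_ ru _|p x].
    have [_ /(_ 0%N)] := depthP u; rewrite leqNgt u0.
    by move: ru => /= -> /(_ (reach_refl _ _)).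
  rewrite rcons_path last_rcons size_rcons => /andP[rp lx] xu pn; subst x.
  have uv : adj u (last (rep u) p) by rewrite adjC.
  exists (last (rep u) p); split=> //; apply/eqP; rewrite eqn_leq.
  rewrite depth_adj ?andbT //; apply: leq_trans pn; rewrite ltnS.
  by apply: (depthP _).2; rewrite (rep_adj _ _ uv); exists p.
have rep0 w : depth w = 0%N -> rep w = w.
  move=> w0; have [[p [_ wp pn]] _] := depthP w.
  by move: pn wp; rewrite w0 leqn0 size_eq0 => /eqP->.
by rewrite !rep0.
Qed.

Lemma odw_le (R : realType) (G : sgraph) (D : tree_decomposition G) n :
  (forall (t : td_tree D) u v, bag t u -> bag t v -> reach n u v) ->
  odw R G <= n%:R%:E.
Proof.
move=> bagP; apply: (@le_trans _ _ (outer_diameter R D)).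
  by apply: ereal_inf_lbound; exists D.
apply: ge_ereal_sup => _ [t _ <-]; apply: ge_ereal_sup => d.
case=> [->|[u tu [v tv <-]]]; first by rewrite lee_fin.
by apply/reachP; apply: bagP tu tv.
Qed.

Lemma mccarty_odw (R : realType) (G : sgraph) k :
  mccarty R G k -> odw R G <= (6 * k + 2)%:R%:E.
Proof.
move=> mcG; have [depth [dadj ddesc droot]] := exists_layering G.
have [|||rep [repP rep_eq]] := exists_repr G (layer_eq depth).
- exact: layer_eq_refl.
- exact: layer_eq_sym.
- exact: layer_eq_trans.
(* [pre] must be total; at depth 0 the condition is vacuous and [u] serves as witness. *)
have /boolp.choice[pre preP] : forall u, exists v,
    (0 < depth u)%N -> adj u v /\ (depth v).+1 = depth u.
  move=> u; have [u0|u0] := posnP (depth u); first by exists u; rewrite u0.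
  by have [v ?] := ddesc _ u0; exists v.
apply: (odw_le _ _ (layer_decomposition _ dadj _ _ repP rep_eq preP)) => t u v.
apply: layer_bag_reach => // x y; exact: layer_reach mcG.
Qed.

(** * From a tree-decomposition to separating balls *)

Section TreeDecompositions.
Context {G : sgraph} (D : tree_decomposition G).

(** Nodes whose bags share a vertex outside [bag t] are joined in the tree off [t]. Following the
    edges of a walk that avoids [bag t], each held by some bag, would thus lead from [a] to [b] off
    [t]. *)
Lemma bag_separates (t a b : td_tree D) (u v : G) :
  ~ walk_in (fun s => s <> t) a b -> bag a u -> bag b v ->
  ~ walk_in (fun z => ~ bag t z) u v.
Proof.
move=> nab au bv [p [up upv pt]]; apply: nab.
have [_ coT _] := td_treeP D.
have same_vertex c d w : bag c w -> bag d w -> ~ bag t w -> walk_in (fun s => s <> t) c d.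
  move=> cw dw tw; have [q cdq] := coT c d.
  exists q; split; [by case/and3P: cdq|by case/and3P: cdq => _ /eqP|].
  by move=> s sq st; apply: tw; rewrite -st; apply: (bag_path cdq sq).
elim: p u a au up upv pt => [|x p IHp] u a au /=.
  by move=> _ uv pt; rewrite -uv in bv; apply: same_vertex (pt u _) => //; exact: mem_head.
move=> /andP[ux xp] xpv pt; have [s [su sx]] := bag_edge D ux.
apply: (walk_in_trans _ _ s); first by apply: same_vertex (pt u _) => //; exact: mem_head.
by apply: (IHp x) => // z zp; apply: pt; rewrite inE zp orbT.
Qed.

Lemma decomposition_mccarty (R : realType) n :
  (forall (t : td_tree D) u v, bag t u -> bag t v -> reach n u v) -> mccarty R G n.
Proof.
move=> bagP u v w _ _ _.
have cover z : exists a : td_tree D, bag a z.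
  have : ([set: G]%classic z) by [].
  by rewrite -(bag_cover D) => -[a _ ?]; exists a.
have [[a au] [b bv] [c cw]] := And3 (cover u) (cover v) (cover w).
have [_ coT acT] := td_treeP D.
have [t [tab tac tbc]] := median acT a b c coT.
have [x xP] : exists x, forall z, bag t z -> reach n x z.
  have [[x tx]|nox] := pselect (exists x, bag t x); first by exists x => z; apply: bagP.
  (* An empty bag lies in every ball, so any vertex serves as centre. *)
  by exists u => z tz; case: nox; exists z.
exists x => C Coff.
have sep y z : ~ walk_in (fun z => ~ bag t z) y z -> ~ (C y /\ C z).
  move=> yz; apply: separatedP Coff => ballyz; apply: yz; apply: walk_in_sub ballyz.
  by move=> s ns ts; apply/ns/reachP/xP.
by split; apply: sep; [apply: bag_separates tab _ _|apply: bag_separates tac _ _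
  |apply: bag_separates tbc _ _].
Qed.

Lemma outer_diameter_ge0 (R : realType) : 0 <= outer_diameter R D.
Proof.
have [[t] _ _] := td_treeP D.
apply: (@le_trans _ _ (diameter R (bag t))); first by apply: ereal_sup_ubound; left.
by apply: ereal_sup_ubound; exists t.
Qed.

Lemma mcw_le_outer_diameter (R : realType) : mcw R G <= outer_diameter R D.
Proof.
have dist_le (t : td_tree D) u v : bag t u -> bag t v ->
    dist R u v <= outer_diameter R D.
  move=> tu tv; apply: (@le_trans _ _ (diameter R (bag t))).
    by apply: ereal_sup_ubound; right; exists u => //; exists v.
  by apply: ereal_sup_ubound; exists t.
case: (outer_diameter R D) dist_le (outer_diameter_ge0 R) => [r| |] // dist_le r0; last exact: leey.
rewrite lee_fin in r0.
(* Distances are natural numbers, so those at most [r] are at most its integer part. *)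
apply: (@le_trans _ _ (Num.truncn r)%:R%:E); last by rewrite lee_fin truncn_le.
apply: ereal_inf_lbound; exists (Num.truncn r) => //.
apply: decomposition_mccarty => t u v tu tv.
have [m uvm mr] := reach_le_dist _ _ _ _ (dist_le _ _ _ tu tv).
by apply: reachW uvm; rewrite truncn_ge_nat.
Qed.

End TreeDecompositions.

(** * Assembling the inequalities in the extended reals *)

Lemma odw_ge0 (R : realType) (G : sgraph) : 0 <= odw R G.
Proof. by apply: le_ereal_inf_tmp => _ [D ->]; apply: outer_diameter_ge0. Qed.

Theorem theorem1p9 (R : realType) (G : sgraph) :
  (odw R G - 3%:E) / 6%:E <= mcw R G /\ mcw R G <= odw R G.
Proof.
split; last by apply: le_ereal_inf_tmp => _ [D ->]; exact: mcw_le_outer_diameter.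
apply: le_ereal_inf_tmp => _ [k /= mcG <-].
(* The bound [6k + 2] rules out [+oo] and [odw_ge0] rules out [-oo]; the claim asks only for
   [6k + 3]. *)
have := mccarty_odw _ _ _ mcG; have := odw_ge0 R G.
case: (odw R G) => [r _| |] //; rewrite lee_fin inver pnatr_eq0 /= => rk.
by rewrite -EFinB -EFinM lee_fin ler_pdivrMr // natrD natrM in rk *; lra.
Qed.
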